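(* Let $\mathcal{A}$ be an alphabet, $\mathcal{V}$ a family of blurred sets of $\mathcal{A}$, $\Lambda\subset\mathcal{A}^{\mathbb{N}}$ a shift space and $\Sigma_\Lambda=\Sigma_\Lambda^{\mathcal{V}}$ its blur shift space with resolution $\mathcal{V}$. Suppose that $\Sigma_\Lambda$ is first countable and that at least one of the following conditions holds: (i) $\mathcal{V}_\Lambda$ is countable; (ii) for each $H\in\mathcal{V}_\Lambda$, only finitely many elements of $H$ belong to some other set of $\mathcal{V}_\Lambda$, that is, $\{h\in H:\ \exists G\in\mathcal{V}_\Lambda \text{ with } G\neq H \text{ and } h\in G\}$ is finite (it is allowed that some element belongs to infinitely many sets of $\mathcal{V}_\Lambda$). Then $\Sigma_\Lambda$ is metrizable.
   Context: $\mathbb{N}=\{0,1,2,\dots\}$; ''countable'' means finite or countably infinite. An alphabet is a nonempty set $\mathcal{A}$. On $\mathcal{A}^{\mathbb{N}}$ the shift map is $\sigma((x_i)_i)=(x_{i+1})_i$. A shift space is a set $\Lambda\subset\mathcal{A}^{\mathbb{N}}$ consisting of all sequences in which no word of some given set of nonempty finite words occurs; equivalently, $\Lambda$ is closed in the product of discrete topologies and $\sigma(\Lambda)\subset\Lambda$. $B_n(\Lambda)$ is the set of words $x_0\dots x_{n-1}$ with $x\in\Lambda$, $B_0(\Lambda)=\{\epsilon\}$ (empty word), $B(\Lambda)=\bigcup_{n\ge0}B_n(\Lambda)$; in particular $B_1(\Lambda)$ is the set of letters occurring in $\Lambda$ and $B(\mathcal{A}^{\mathbb{N}})$ is the set of all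 finite words. For a word $w$, $\mathcal{F}_\Lambda(w)=\{a\in\mathcal{A}:\ wa\in B(\Lambda)\}$. A family of blurred sets (a resolution) is any (possibly empty) family $\mathcal{V}$ of infinite subsets of $\mathcal{A}$ such that $|G\cap H|<\infty$ for all distinct $G,H\in\mathcal{V}$. To each $H\in\mathcal{V}$ one attaches a new symbol $\tilde H\notin\mathcal{A}$ (distinct symbols for distinct sets); $\tilde{\mathcal{V}}=\{\tilde H: H\in\mathcal{V}\}$, $\bar{\mathcal{A}}=\mathcal{A}\cup\tilde{\mathcal{V}}$, $\bar H=H\cup\{\tilde H\}$. The full blur shift is $\Sigma_{\mathcal{A}^{\mathbb{N}}}^{\mathcal{V}}=\mathcal{A}^{\mathbb{N}}\cup\{(x_0\dots x_{n-1}\tilde H\tilde H\tilde H\dots):\ n\ge0,\ x_i\in\mathcal{A},\ H\in\mathcal{V}\}$. The blur shift space of $\Lambda$ is $\Sigma_\Lambda^{\mathcal{V}}=\Lambda\cup\{(a_0\dots a_{n-1}\tilde H\tilde H\dots):\ n\ge0,\ H\in\mathcal{V},\ a_0\dots a_{n-1}\in B(\Lambda),\ |\mathcal{F}_\Lambda(a_0\dots a_{n-1})\cap H|=\infty\}$. Also $\mathcal{V}_\Lambda=\{H\in\mathcal{V}:\ |B_1(\Lambda)\cap H|=\infty\}$. Topology: $\Sigma_{\mathcal{A}^{\mathbb{N}}}^{\mathcal{V}}$ carries the topology with basis the generalized cylinders $Z(w_0\dots w_{n-1})=\{x: x_i=w_i,\ 0\le i\le n-1\}$ and $Z(w_0\dots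 w_{n-1}\bar H,F)=\{x: x_i=w_i,\ 0\le i\le n-1,\ x_n\in\bar H\setminus F\}$, where $n\ge0$, $w_i\in\mathcal{A}$, $H\in\mathcal{V}$, $F\subset H$ finite; $\Sigma_\Lambda^{\mathcal{V}}$ carries the induced topology. *)

(* Defs.v *)
From HB Require Import structures.
From mathcomp Require Import all_boot all_order all_algebra.
From mathcomp Require Import all_classical all_reals all_analysis.
Set Implicit Arguments.
Unset Strict Implicit.
Unset Printing Implicit Defensive.
Import Order.TTheory GRing.Theory Num.Theory.
Local Open Scope classical_set_scope.
Local Open Scope ring_scope.

Definition first_countable (T : topologicalType) : Prop :=
  forall x : T, exists B : set (set T),
    [/\ countable B, B `<=` nbhs x &
        forall U, nbhs x U -> exists2 W, B W & W `<=` U].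

Definition is_metric (R : realType) (T : Type) (d : T -> T -> R) : Prop :=
  [/\ forall x y, 0 <= d x y,
      forall x y, d x y = 0 <-> x = y,
      forall x y, d x y = d y x &
      forall x y z, d x z <= d x y + d y z].

Definition metrizable (R : realType) (T : topologicalType) : Prop :=
  exists2 d : T -> T -> R, is_metric d &
    forall x : T, nbhs x = nbhs_ball_ (fun y e => [set z | d y z < e]) x.

Section ShiftSpaces.
Variable A : pointedType.
Implicit Types (L : set (nat -> A)) (w : seq A) (x : nat -> A).

Definition occurs w x : Prop :=
  exists k : nat, w = mkseq (fun i => x (k + i)%N) (size w).

Definition shift_space L : Prop :=
  exists2 F : set (seq A), ~ F [::] &
    L = [set x | forall w, F w -> ~ occurs w x].

(* The case n = 0 is separate so that the empty word also belongs to the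
   language of the empty shift space. *)
Definition words n L : set (seq A) :=
  if n is 0%N then [set [::]] else [set mkseq x n | x in L].

Definition language L : set (seq A) := \bigcup_n words n L.

Definition letters L : set A := [set a | words 1 L [:: a]].

Definition follower L w : set A := [set a | language L (rcons w a)].

Definition resolution (V : set (set A)) : Prop :=
  (forall H, V H -> infinite_set H) /\
  (forall G H, V G -> V H -> G <> H -> finite_set (G `&` H)).

Definition resolution_in (V : set (set A)) L : set (set A) :=
  [set H | V H /\ infinite_set (letters L `&` H)].

Section FullBlurShift.
Variable V : set (set A).

(* [inl a] is the letter a, and [inr H] is the new symbol attached to H. *)
Definition ext_alphabet : Type := (A + V)%type.

Definition ext_seq x : nat -> ext_alphabet := fun i => inl (x i).

(* The sequence w H~ H~ H~ ..., by the default value of [nth]. *)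
Definition blur_seq w (H : V) : nat -> ext_alphabet := nth (inr H) (map inl w).

Definition full_blur_set : set (nat -> ext_alphabet) :=
  range ext_seq `|` [set y | exists w H, y = blur_seq w H].

(* An alias of the subtype, so that it can carry its own topology. *)
Definition full_blur_shift : Type := set_type full_blur_set.

HB.instance Definition _ := gen_eqMixin full_blur_shift.
HB.instance Definition _ := gen_choiceMixin full_blur_shift.

Definition blur_val (y : full_blur_shift) : nat -> ext_alphabet := sval y.

Definition bar (H : V) : set ext_alphabet :=
  [set inl a | a in val H] `|` [set inr H].

Definition cylinder w : set full_blur_shift :=
  [set y | mkseq (blur_val y) (size w) = map inl w].

Definition bar_cylinder w (H : V) (F : set A) : set full_blur_shift :=
  [set y | cylinder w y /\ (bar H `\` [set inl a | a in F]) (blur_val y (size w))].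

Definition generalized_cylinders : set (set full_blur_shift) :=
  range cylinder `|`
  [set Z | exists w H F,
     [/\ finite_set F, F `<=` val H & Z = bar_cylinder w H F]].

Lemma cylinderP w y : cylinder w y <->
  forall i, (i < size w)%N -> blur_val y i = inl (nth point w i).
Proof.
split=> [E i iw|E].
  by rewrite -(nth_mkseq (inl point) (blur_val y) iw) E (nth_map point).
apply: (@eq_from_nth _ (inl point)); rewrite size_mkseq ?size_map// => i iw.
by rewrite nth_mkseq// (nth_map point)// E.
Qed.

Lemma generalized_cylinders_cover :
  \bigcup_(Z in generalized_cylinders) id Z = [set: full_blur_shift].
Proof.
apply/seteqP; split=> // y _; exists (cylinder [::]); last by [].
by left; exists [::].
Qed.

(* Membership in a generalized cylinder Z depends only on a bounded number of
   letters of y, as long as these are not new symbols. *)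
Lemma generalized_cylinder_letters Z : generalized_cylinders Z ->
  exists n, forall (w : seq A) (y z : full_blur_shift), (n <= size w)%N ->
    cylinder w y -> cylinder w z -> Z y -> Z z.
Proof.
case=> [[u _ <-]|[u [H [F [_ _ ->]]]]].
  exists (size u) => w y z uw /cylinderP wy /cylinderP wz /cylinderP uy.
  apply/cylinderP => i iu; rewrite -uy// wy ?wz//; exact: leq_trans uw.
exists (size u).+1 => w y z uw /cylinderP wy /cylinderP wz [/cylinderP uy Fy].
split; last by rewrite wz// -wy.
apply/cylinderP => i iu; rewrite -uy// wy ?wz//;
  by rewrite (leq_trans _ uw)// ltnS ltnW.
Qed.

Lemma generalized_cylinder_blur Z w H (y : full_blur_shift) :
  generalized_cylinders Z -> blur_val y = blur_seq w H -> Z y ->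
  exists F, [/\ finite_set F, F `<=` val H & bar_cylinder w H F `<=` Z].
Proof.
move=> + yE.
have yw i : (i < size w)%N -> blur_val y i = inl (nth point w i).
  by move=> iw; rewrite yE /blur_seq (nth_map point).
have yH i : (size w <= i)%N -> blur_val y i = inr H.
  by move=> iw; rewrite yE /blur_seq nth_default// size_map.
have lew u : cylinder u y -> (size u <= size w)%N.
  move=> /cylinderP uy; rewrite leqNgt; apply/negP => wu.
  by move: (uy _ wu); rewrite yH.
case=> [[u _ <-] uy|[u [G [F [finF FG ->]]]] [uy Fy]].
  exists set0; split=> // z [/cylinderP wz _].
  have uw := lew _ uy; move/cylinderP : uy => uy.
  apply/cylinderP => i iu; have iw := leq_trans iu uw.
  by rewrite -uy// yw// wz.
have uw := lew _ uy; move/cylinderP : uy => uy.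
have cyl z : cylinder w z -> cylinder u z.
  move=> /cylinderP wz; apply/cylinderP => i iu; have iw := leq_trans iu uw.
  by rewrite -uy// yw// wz.
move: uw; rewrite leq_eqVlt => /orP[/eqP uw|uw].
  move: Fy; rewrite uw yH// => -[[[a _]//|/= [GE]] _]; subst G.
  by exists F; split=> // z [/cyl uz]; split=> //; rewrite uw.
exists set0; split=> // z [wz _]; split; first exact: cyl.
by move: wz => /cylinderP wz; rewrite wz// -yw.
Qed.

Lemma generalized_cylinders_join (Z1 Z2 : set full_blur_shift) y :
  generalized_cylinders Z1 -> generalized_cylinders Z2 -> Z1 y -> Z2 y ->
  exists Z, [/\ generalized_cylinders Z, Z y & Z `<=` Z1 `&` Z2].
Proof.
move=> Z1b Z2b Z1y Z2y; have [[x _ xy]|[w [H yE]]] := set_valP y.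
  have [n1 h1] := generalized_cylinder_letters Z1b.
  have [n2 h2] := generalized_cylinder_letters Z2b.
  pose w := mkseq x (maxn n1 n2).
  have wy : cylinder w y.
    apply/cylinderP => i; rewrite size_mkseq => iw.
    by rewrite nth_mkseq// /blur_val -[sval y]/(val y) -xy.
  exists (cylinder w); split=> //; first by left; exists w.
  move=> z wz; split.
    by apply: (h1 _ _ _ _ wy wz) => //; rewrite size_mkseq leq_maxl.
  by apply: (h2 _ _ _ _ wy wz) => //; rewrite size_mkseq leq_maxr.
have [F1 [fin1 F1H s1]] := generalized_cylinder_blur Z1b yE Z1y.
have [F2 [fin2 F2H s2]] := generalized_cylinder_blur Z2b yE Z2y.
exists (bar_cylinder w H (F1 `|` F2)); split.
- by right; exists w, H, (F1 `|` F2); split=> //;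
    [rewrite finite_setU|rewrite subUset].
- split; first by apply/cylinderP => i iw;
    rewrite /blur_val -[sval y]/(val y) yE /blur_seq (nth_map point).
  rewrite /blur_val -[sval y]/(val y) yE /blur_seq nth_default ?size_map//.
  by split=> [|[a _]//]; right.
- move=> z [wz [Hz F12z]]; split.
    by apply: s1; split=> //; split=> // -[a Fa az];
      apply: F12z; exists a => //; left.
  by apply: s2; split=> //; split=> // -[a Fa az];
    apply: F12z; exists a => //; right.
Qed.

HB.instance Definition _ := isBaseTopological.Build full_blur_shift
  generalized_cylinders_cover generalized_cylinders_join.

(* The space itself is [set_type (blur_shift V L)], whose topology is the one
   induced by [full_blur_shift]. *)
Definition blur_shift L : set full_blur_shift :=
  [set y | (exists2 x, L x & blur_val y = ext_seq x) \/
           (exists w (H : V), [/\ language L w,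
              infinite_set (follower L w `&` val H) &
              blur_val y = blur_seq w H])].

End FullBlurShift.

End ShiftSpaces.

Arguments blur_shift {A} V L _.
Arguments generalized_cylinders {A} V _.

(* Main.v *)
Require Import Defs.
From mathcomp Require Import all_boot all_order all_algebra.
From mathcomp Require Import all_classical all_reals all_analysis.

(** The obstruction to metrizability is the overlap of the blurred sets: already
    the one-letter space, where the neighbourhoods of the symbol H~ are the
    cofinite parts of H together with H~, is a Mrowka space.  Under either
    condition the overlaps can be cut away: each H in V_L has a core D H,
    obtained from H by removing finitely many letters, and the cores are
    pairwise disjoint ([disjoint_cores]).  First countability at the point
    H~ H~ H~ ... forces H to contain only countably many letters of L
    ([first_countable_letters]), so the letters of a core can be numbered by an
    injective rank.  Near H~, the letters of L look like a single sequence
    converging to H~.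

    For k : nat, let [coarsen k] replace by H~ every letter of the core of H of
    rank at least k, and let [truncation k] read a point through [coarsen k] for
    k steps, stopping at the first symbol H~ that appears.  Stopping there is
    essential: a basic neighbourhood of w H~ H~ ... restricts the letter that
    follows w, and nothing after it, so the topology is not that of a product.
    Every truncation is locally constant ([nbhs_truncation]) because only
    finitely many letters of H which occur in L are far from H~, that is, of
    rank less than k or outside the core.  Conversely the fibres of the
    truncations form local bases ([truncation_sub_nbhs]) and separate points
    ([truncation_inj]), because for k large [coarsen k] fixes any given symbol.
    A topology governed in this way by a sequence of locally constant maps is
    given by the metric 1/(m+1), where m is the first index at which two points
    are separated ([metrizable_locally_constant]). *)

Set Implicit Arguments.
Unset Strict Implicit.
Unset Printing Implicit Defensive.
Import Order.TTheory GRing.Theory Num.Theory.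
Local Open Scope classical_set_scope.
Local Open Scope ring_scope.

(** * Metrics from sequences of locally constant maps *)

Section SeparationDistance.
Variables (R : realType) (T : Type) (Y : nat -> Type) (f : forall k, T -> Y k).

Definition separation_distance (x y : T) : R :=
  if pselect (exists k, `[< f k x <> f k y >]) is left e
  then (ex_minn e).+1%:R^-1 else 0.

Lemma separation_distance_lt x y k : separation_distance x y < k.+1%:R^-1 ->
  f k x = f k y.
Proof.
rewrite /separation_distance; case: pselect => [e|ne _].
  case: ex_minnP => m _ mmin ltmk; apply: contrapT => fk.
  have /mmin : `[< f k x <> f k y >] by apply/asboolP.
  move: ltmk; rewrite ltf_pV2 ?posrE ?ltr0n// ltr_nat ltnS => km mk.
  by move: (leq_trans km mk); rewrite ltnn.
by apply: contrapT => fk; apply: ne; exists k; apply/asboolP.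
Qed.

Lemma separation_distance_neq0 x y : separation_distance x y != 0 ->
  exists2 m, f m x <> f m y & separation_distance x y = m.+1%:R^-1.
Proof.
rewrite /separation_distance; case: pselect => [e _|ne]; last by rewrite eqxx.
by case: ex_minnP => m /asboolP fm _; exists m.
Qed.

Lemma separation_distance_ge0 x y : 0 <= separation_distance x y.
Proof. by rewrite /separation_distance; case: pselect. Qed.

Lemma is_metric_separation_distance :
  (forall x y, (forall k, f k x = f k y) -> x = y) ->
  is_metric separation_distance.
Proof.
move=> sepf; split=> [||x y|x y z]; first exact: separation_distance_ge0.
- move=> x y; split=> [d0|->].
    by apply: sepf => k; apply: separation_distance_lt; rewrite d0.
  by apply/eqP/negPn/negP => /separation_distance_neq0[m].
- suff le u v : separation_distance u v <= separation_distance v u.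
    by apply/eqP; rewrite eq_le !le.
  have [->|] := eqVneq (separation_distance u v) 0.
    exact: separation_distance_ge0.
  move=> /separation_distance_neq0[m fuv ->]; rewrite leNgt; apply/negP => lt.
  by apply: fuv; rewrite (separation_distance_lt lt).
- have [->|] := eqVneq (separation_distance x z) 0.
    by rewrite addr_ge0// separation_distance_ge0.
  move=> /separation_distance_neq0[m fxz ->]; rewrite leNgt; apply/negP => lt.
  apply: fxz; transitivity (f m y); apply: separation_distance_lt;
    apply: le_lt_trans lt.
    by rewrite lerDl separation_distance_ge0.
  by rewrite lerDr separation_distance_ge0.
Qed.

End SeparationDistance.

(** The first hypothesis makes the balls of the separation distance
    neighbourhoods, since a ball constrains finitely many of the maps; the
    second makes them small enough. *)
Lemma metrizable_locally_constant (R : realType) (T : topologicalType)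
    (Y : nat -> Type) (f : forall k, T -> Y k) :
  (forall k (x : T), nbhs x [set z | f k z = f k x]) ->
  (forall (x : T) U, nbhs x U -> exists k, [set z | f k z = f k x] `<=` U) ->
  (forall x y, (forall k, f k x = f k y) -> x = y) ->
  metrizable R T.
Proof.
move=> fcst fbase fsep.
exists (separation_distance R f); first exact: is_metric_separation_distance.
move=> x; apply/seteqP; split=> [U /fbase[k kU]|U [e /= e0 eU]].
  exists k.+1%:R^-1 => /=; first by rewrite invr_gt0 ltr0n.
  by move=> z /= dz; apply: kU; rewrite /= (separation_distance_lt dz).
have [n ne] : exists n, n.+1%:R^-1 < e.
  exists (Num.truncn e^-1); rewrite invf_plt ?posrE ?ltr0n//.
  exact: truncnS_gt.
have near_eq : \forall z \near x, forall j : 'I_n.+1, f j z = f j x.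
  by apply: filter_forall => j; exact: fcst.
apply: filterS near_eq => z fz; apply: eU => /=.
have [->//|] := eqVneq (separation_distance R f x z) 0.
move=> /(@separation_distance_neq0 R T Y f)[m fm ->].
apply: le_lt_trans ne; rewrite lef_pV2 ?posrE ?ltr0n// ler_nat ltnS.
rewrite leqNgt; apply/negP => mn; apply: fm.
by rewrite (fz (Ordinal (ltnW mn : (m < n.+1)%N))).
Qed.

(** * Making the blurred sets disjoint *)

Lemma finite_injective_lt (T : Type) (B : set T) (f : T -> nat) (n : nat) :
  {in B &, injective f} -> finite_set [set x | B x /\ (f x < n)%N].
Proof.
move=> finj; set C := [set x | _].
have CB : {in C &, injective f}.
  by move=> x y /set_mem[Bx _] /set_mem[By _]; apply: finj; exact: mem_set.
rewrite -(eq_finite_set (inj_card_eq CB)).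
by apply: sub_finite_set (finite_II n) => _ [x [_ xn] <-].
Qed.

(** In the countable case the members of W are enumerated and a point is given
    to the first member containing it: H loses its intersections with finitely
    many earlier members.  In the other case a point is kept when it lies in a
    single member of W. *)
Lemma disjoint_cores (T : Type) (W : set (set T)) :
  (forall G H, W G -> W H -> G <> H -> finite_set (G `&` H)) ->
  (countable W \/
     forall H, W H ->
       finite_set [set h | H h /\ exists G, [/\ W G, G <> H & G h]]) ->
  exists D : set T -> set T,
    [/\ forall H, D H `<=` H,
        forall G H a, W G -> W H -> D G a -> D H a -> G = H &
        forall H, W H -> finite_set (H `\` D H)].
Proof.
move=> Wad [/countable_injP[f finj]|Wii].
- exists (fun H => [set a | H a /\ forall G, W G -> G a -> (f H <= f G)%N]).
  split=> [H a []//|G H a WG WH [Ga Gle] [Ha Hle]|H WH].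
    apply: finj; [exact: mem_set|exact: mem_set|].
    by apply/eqP; rewrite eqn_leq Gle// Hle.
  pose earlier := [set G | W G /\ (f G < f H)%N].
  apply: (@sub_finite_set _ _ (\bigcup_(G in earlier) (G `&` H))); last first.
    apply: bigcup_finite => [|G [WG GH]]; first exact: finite_injective_lt.
    by apply: Wad => // E; move: GH; rewrite E ltnn.
  move=> a [Ha nDa]; apply: contrapT => na; apply: nDa; split=> // G WG Ga.
  by rewrite leqNgt; apply/negP => GH; apply: na; exists G.
- exists (fun H => [set a | H a /\ forall G, W G -> G a -> G = H]).
  split=> [H a []//|G H a WG WH [Ga _] [Ha Heq]|H WH]; first exact: Heq.
  apply: sub_finite_set (Wii _ WH) => a [Ha nDa]; split=> //.
  apply: contrapT => na; apply: nDa; split=> // G WG Ga.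
  by apply: contrapT => GH; apply: na; exists G.
Qed.

(** * Points, letters and neighbourhoods in a blur shift space *)

Section Letters.
Variables (A : pointedType) (V : set (set A)) (L : set (nat -> A)).
Local Notation X := (set_type (blur_shift V L)).
Implicit Types (y z : X) (H : V).

Definition entry y : nat -> ext_alphabet V := blur_val (val y).

Lemma entry_inj y z : (forall i, entry y i = entry z i) -> y = z.
Proof. by move=> yz; do 2 apply: val_inj; apply/funext. Qed.

Lemma entry_blur y H j i : entry y j = inr H -> (j <= i)%N -> entry y i = inr H.
Proof.
rewrite /entry; case: (set_valP y) => [[x _ ->]//|[w [G [_ _ ->]]]].
rewrite /blur_seq => + ji; have [jw|wj] := ltnP j (size w).
  by rewrite (nth_map point).
rewrite nth_default ?size_map// => -[->].
by rewrite nth_default// size_map (leq_trans wj).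
Qed.

Lemma letters_shift x i : shift_space L -> L x -> letters L (x i).
Proof.
move=> [F _ LE] Lx.
exists (fun k => x (i + k)%N); last by rewrite /mkseq/= addn0.
move: Lx; rewrite LE => Lx w Fw [k wE]; apply: (Lx w Fw).
by exists (i + k)%N; rewrite wE size_mkseq; apply: eq_mkseq => j; rewrite addnA.
Qed.

Lemma letters_language w i : shift_space L -> language L w ->
  (i < size w)%N -> letters L (nth point w i).
Proof.
move=> hL [[|n] _ /=]; first by move=> ->.
move=> [x Lx <-]; rewrite size_mkseq => iw; rewrite nth_mkseq//.
exact: letters_shift.
Qed.

Lemma letters_entry y i a : shift_space L -> entry y i = inl a -> letters L a.
Proof.
rewrite /entry => hL; case: (set_valP y) => [[x Lx ->] [<-]|].
  exact: letters_shift.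
move=> [w [G [Lw _ ->]]]; rewrite /blur_seq; have [iw|wi] := ltnP i (size w).
  by rewrite (nth_map point)// => -[<-]; exact: letters_language.
by rewrite nth_default ?size_map.
Qed.

(** By shift invariance the followers of any word are letters of L, so a set
    that meets the followers of a word infinitely often meets the letters of L
    infinitely often: the symbols of all blur points come from V_L. *)
Lemma resolution_in_entry y i H : shift_space L -> entry y i = inr H ->
  resolution_in V L (val H).
Proof.
rewrite /entry => hL; case: (set_valP y) => [[x _ ->]//|].
move=> [w [G [_ Gw ->]]]; rewrite /blur_seq; have [iw|wi] := ltnP i (size w).
  by rewrite (nth_map point).
rewrite nth_default ?size_map// => -[<-].
split; first exact: set_valP.
apply: contra_not Gw; apply: sub_finite_set => a [wa Ga]; split=> //.
have := @letters_language _ (size w) hL wa.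
by rewrite size_rcons nth_rcons ltnn eqxx; apply.
Qed.

Lemma nbhs_generalized_cylinder Z y : generalized_cylinders V Z ->
  Z (val y) -> nbhs y [set z | Z (val z)].
Proof.
move=> Zb Zy; exists [set z | Z (val z)]; split=> //.
exists Z => //; exists [set Z]; first by move=> _ ->.
by rewrite bigcup_set1.
Qed.

Lemma generalized_cylinder_sub_nbhs y U : nbhs y U ->
  exists Z, [/\ generalized_cylinders V Z, Z (val y) &
                forall z, Z (val z) -> U z].
Proof.
move=> [_ [[_ [D Db <-] <-] [Z DZ Zy]] sU]; exists Z; split=> //.
  exact: Db.
by move=> z Zz; apply: sU; exists Z.
Qed.

Lemma blur_point_in H : resolution_in V L (val H) ->
  exists y : X, entry y 0%N = inr H.
Proof.
move=> [_ LH].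
have Fy : full_blur_set (blur_seq [::] H) by right; exists [::], H.
pose y : full_blur_shift V := SigSub (mem_set Fy).
have By : blur_shift V L y.
  right; exists [::], H; split=> //; first by exists 0%N.
  apply: contra_not LH; apply: sub_finite_set => a [La Ha]; split=> //.
  by exists 1%N.
by exists (SigSub (mem_set By)).
Qed.

Lemma letter_point_in a : letters L a -> exists y : X, entry y 0%N = inl a.
Proof.
move=> [x Lx [xa]].
have Fy : full_blur_set (ext_seq V x) by left; exists x.
pose y : full_blur_shift V := SigSub (mem_set Fy).
have By : blur_shift V L y by left; exists x.
by exists (SigSub (mem_set By)); rewrite /entry/blur_val/= /ext_seq xa.
Qed.

(** A member W of the local base at H~ H~ ... contains a set Z(H-bar, F) with F
    finite, so among the letters of L in H only those of F can fail to start a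
    point of W.  Every such letter a is missed by some W, one that is contained in Z(H-bar, {a}). *)
Lemma first_countable_letters H : first_countable X ->
  resolution_in V L (val H) -> countable (letters L `&` val H).
Proof.
move=> fcX /blur_point_in[y yH]; have [B [cB By Bbase]] := fcX y.
pose missed (W : set X) :=
  [set a | (letters L `&` val H) a /\ forall z, W z -> entry z 0%N <> inl a].
apply: (@sub_countable _ _ _ (\bigcup_(W in B) missed W)); last first.
  apply: bigcup_countable => // W /By Wy; apply: finite_set_countable.
  have [Z [Zb Zy ZW]] := generalized_cylinder_sub_nbhs Wy.
  have yE : blur_val (val y) = blur_seq [::] H.
    apply/funext => i; rewrite /blur_seq nth_nil.
    exact: entry_blur yH (leq0n i).
  have [F [finF _ FZ]] := generalized_cylinder_blur Zb yE Zy.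
  apply: sub_finite_set finF => a [[La Ha] aW].
  apply: contrapT => nFa; have [z za] := letter_point_in La.
  apply: (aW z) => //; apply: ZW; apply: FZ; split=> //=.
  rewrite -/(entry z 0%N) za; split; first by left; exists a.
  by move=> [b Fb [ba]]; apply: nFa; rewrite -ba.
apply: subset_card_le => a [La Ha].
have Za : generalized_cylinders V (bar_cylinder [::] H [set a]).
  right; exists [::], H, [set a]; split=> //.
  by move=> _ ->.
have Zy : bar_cylinder [::] H [set a] (val y).
  split=> //=; rewrite -/(entry y 0%N) yH.
  by split; [right|move=> []].
have [W BW Wa] := Bbase _ (nbhs_generalized_cylinder Za Zy).
exists W => //; split=> // z /Wa[_ [_ za]] zE; apply: za; by exists a.
Qed.

End Letters.

(** * Truncations *)

Section Truncation.
Variables (A : pointedType) (V : set (set A)) (L : set (nat -> A)).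
Variables (owner : A -> option V) (rank : A -> nat).
Local Notation X := (set_type (blur_shift V L)).
Implicit Types (y z : X) (H : V) (u : ext_alphabet V).

Definition coarsen k u : ext_alphabet V :=
  match u with
  | inl a => if owner a is Some H then if (k <= rank a)%N then inr H else u
             else u
  | inr _ => u
  end.

Definition symbol_rank u : nat := if u is inl a then rank a else 0%N.

Definition is_letter u : bool := if u is inl _ then true else false.

Lemma coarsen_id k u : (symbol_rank u < k)%N -> coarsen k u = u.
Proof. by case: u => //= a ak; case: owner => // H; rewrite leqNgt ak. Qed.

Lemma coarsen_letter k u a : coarsen k u = inl a -> u = inl a.
Proof. by case: u => //= b; case: owner => // H; case: leqP. Qed.

Lemma coarsen_blur k u H : coarsen k u = inr H ->
  u = inr H \/ exists a, [/\ u = inl a, owner a = Some H & (k <= rank a)%N].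
Proof.
case: u => [a|G] /=; last by move=> [->]; left.
case E : owner => [G|]//; case: leqP => // ka [<-].
by right; exists a.
Qed.

(** A word is encoded as a function that takes the value [None] past its end. *)
Definition truncation k y : nat -> option (ext_alphabet V) := fun i =>
  if (i < k)%N && all (fun j => is_letter (coarsen k (entry y j))) (iota 0 i)
  then Some (coarsen k (entry y i)) else None.

Lemma truncation_letters k y z n :
  truncation k z = truncation k y -> (n < k)%N ->
  (forall j, (j < n)%N -> is_letter (coarsen k (entry y j))) ->
  coarsen k (entry z n) = coarsen k (entry y n).
Proof.
move=> E nk yn; move: (congr1 (@^~ n) E); rewrite /truncation nk /=.
have -> : all (fun j => is_letter (coarsen k (entry y j))) (iota 0 n).
  by apply/allP => j; rewrite mem_iota add0n => /yn.
by case: ifP => // _ [].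
Qed.

(** Agreement is asked only along the truncation of y: as long as the two points
    agree there, the reading of z stops at the same place as that of y. *)
Lemma eq_truncation k y z :
  (forall i, (i < k)%N ->
     all (fun j => is_letter (coarsen k (entry y j))) (iota 0 i) ->
     coarsen k (entry z i) = coarsen k (entry y i)) ->
  truncation k z = truncation k y.
Proof.
move=> yz.
have allE i : (i <= k)%N ->
    all (fun j => is_letter (coarsen k (entry z j))) (iota 0 i) =
    all (fun j => is_letter (coarsen k (entry y j))) (iota 0 i).
  elim: i => // i IH ik; rewrite -addn1 iotaD !all_cat IH 1?ltnW//.
  by case: (boolP (all _ _)) => //= yi; rewrite add0n yz.
apply/funext => i; rewrite /truncation; case: ltnP => //= ik.
by rewrite allE 1?ltnW//; case: ifP => // yi; rewrite yz.
Qed.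

Lemma truncation_inj y z : (forall k, truncation k y = truncation k z) -> y = z.
Proof.
move=> yz; apply: entry_inj; elim/ltn_ind => i IH.
(* After a blur symbol both points are constant; before any, the truncations
   have not stopped and reveal the i-th entries. *)
have [[j ji [H jH]]|nblur] :=
    pselect (exists2 j, (j < i)%N & exists H, entry y j = inr H).
  rewrite (entry_blur jH (ltnW ji)); rewrite IH// in jH.
  by rewrite (entry_blur jH (ltnW ji)).
(* This k is beyond the ranks of the entries of z up to i and of the i-th entry
   of y, so coarsening fixes all of them. *)
pose k := (i + (symbol_rank (entry y i) +
           \max_(j < i.+1) symbol_rank (entry z j))).+1.
have zk (j : 'I_i.+1) : (symbol_rank (entry z j) < k)%N.
  by rewrite ltnS !addnA (leq_trans _ (leq_addl _ _))// (leq_bigmax j).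
have yik : (symbol_rank (entry y i) < k)%N.
  by rewrite ltnS addnCA leq_addr.
rewrite -(coarsen_id yik) -(coarsen_id (zk ord_max)).
apply: truncation_letters => //; first by rewrite ltnS leq_addr.
move=> j ji; rewrite (coarsen_id (zk (Ordinal (ltnW ji : (j < i.+1)%N)))) /=.
case zj : (entry z j) => [//|H]; exfalso; apply: nblur; exists j => //.
by exists H; rewrite IH.
Qed.

Hypothesis owner_mem : forall a H, owner a = Some H -> val H a.

(** A generalized cylinder is decided by finitely many symbols: its word w, the
    finite set F of excluded letters and the entry of y after w.  For k beyond
    all their ranks, points with the same k-th truncation as y have the same
    prefix w; the next entry is that of y, unless the latter is H~, when it can
    also be a letter of H of rank at least k, hence outside F. *)
Lemma truncation_sub_nbhs y U : nbhs y U ->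
  exists k, [set z | truncation k z = truncation k y] `<=` U.
Proof.
move=> /generalized_cylinder_sub_nbhs[Z [Zb Zy ZU]].
suff [k kZ] : exists k, forall z, truncation k z = truncation k y -> Z (val z).
  by exists k => z /kZ/ZU.
have prefix w k z : (size w < k)%N ->
    (forall a, a \in w -> (rank a < k)%N) -> cylinder w (val y) ->
    truncation k z = truncation k y ->
    cylinder w (val z) /\
    coarsen k (entry z (size w)) = coarsen k (entry y (size w)).
  move=> wk rk /cylinderP wy E.
  have yw i : (i < size w)%N -> coarsen k (entry y i) = inl (nth point w i).
    by move=> iw; rewrite /entry wy// coarsen_id//= rk// mem_nth.
  split; last by apply: truncation_letters => // j /yw ->.
  apply/cylinderP => i iw; apply: (@coarsen_letter k).
  rewrite -yw//; apply: truncation_letters => // [|j ji].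
    exact: ltn_trans wk.
  by rewrite yw// (ltn_trans ji).
case: Zb Zy => [[w _ <-] wy|[w [H [F [finF FH ->]]]] [wy [Hy Fy]]].
  exists (size w + \max_(a <- w) rank a).+1 => z E.
  apply: (prefix _ _ _ _ _ wy E).1; first by rewrite ltnS leq_addr.
  by move=> a aw; rewrite ltnS (leq_trans _ (leq_addl _ _))// leq_bigmax_seq.
have /finite_seqP[s sF] := finF.
set u := blur_val _ _ in Hy Fy.
pose k := (size w + (symbol_rank u +
           (\max_(a <- w) rank a + \max_(a <- s) rank a))).+1.
have uk : (symbol_rank u < k)%N by rewrite ltnS addnCA leq_addr.
have Fk a : F a -> (rank a < k)%N.
  rewrite sF /= => a_s; rewrite ltnS !addnA (leq_trans _ (leq_addl _ _))//.
  by rewrite leq_bigmax_seq.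
exists k => z E; have [] := prefix w k z _ _ wy E.
- by rewrite ltnS leq_addr.
- move=> a aw; rewrite ltnS addnCA [(size w + _)%N]addnCA addnCA.
  by apply: leq_trans (leq_addr _ _); rewrite leq_bigmax_seq.
- move=> wz; rewrite [in X in _ = X]/entry -/u (coarsen_id uk) => zu.
  split=> //; rewrite -/(entry z _); move: zu Hy Fy.
  case: (u) => [a /coarsen_letter ->//|G + [[]//|/= [GH]] _].
  rewrite -GH => /coarsen_blur[->|[a [-> /owner_mem Ga ka]]].
    by split; [right|move=> []].
  split; first by left; exists a.
  by move=> [b /Fk bk [ba]]; move: bk; rewrite ba ltnNge ka.
Qed.

Hypothesis hL : shift_space L.
Hypothesis far_finite : forall H k, resolution_in V L (val H) -> finite_set
  [set a | [/\ letters L a, val H a & ~ (owner a = Some H /\ (k <= rank a)%N)]].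

(** Each of the first k entries of the truncation is locally constant.  At a
    letter of y this is witnessed by a cylinder; at the symbol H~ it is
    witnessed by Z(w H-bar, F), where F consists of the letters of L in H that
    [coarsen k] does not send to H~.  Restricting F to the letters of L is what
    makes it finite. *)
Lemma nbhs_truncation k y : nbhs y [set z | truncation k z = truncation k y].
Proof.
pose same i z := all (fun j => is_letter (coarsen k (entry y j))) (iota 0 i) ->
  coarsen k (entry z i) = coarsen k (entry y i).
have near_same : \forall z \near y, forall i : 'I_k, same i z.
  apply: (@filter_forall X _ (fun i : 'I_k => same i) _ (nbhs_filter y)) => i.
  pose before := all (fun j => is_letter (coarsen k (entry y j))) (iota 0 i).
  rewrite /same -/before.
  have [/allP yi|_] := boolP before; last exact: (@filterE _ _ (nbhs_filter y)).
  pose w := mkseq (fun j => if entry y j is inl a then a else point) i.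
  have wE j : (j < size w)%N -> blur_val (val y) j = inl (nth point w j).
    rewrite size_mkseq => ji; rewrite nth_mkseq// -/(entry y j).
    have := yi j; rewrite mem_iota add0n => /(_ ji).
    by case: (entry y j).
  case yE : (entry y i) => [a|H].
    have Zy : cylinder (rcons w a) (val y).
      apply/cylinderP => j; rewrite size_rcons ltnS leq_eqVlt nth_rcons.
      case: ltngtP => //= [/wE//|-> _]; rewrite size_mkseq.
      by rewrite -/(entry y i) yE.
    have Zb : generalized_cylinders V (cylinder (rcons w a)).
      by left; exists (rcons w a).
    have nZ := nbhs_generalized_cylinder Zb Zy.
    apply: (@filterS _ _ (nbhs_filter y) _ _ _ nZ) => z /cylinderP/(_ i) + _.
    rewrite size_rcons size_mkseq nth_rcons size_mkseq ltnn eqxx -/(entry z i).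
    by move=> ->.
  have far := far_finite k (resolution_in_entry hL yE).
  set F := (X in finite_set X) in far.
  have Zb : generalized_cylinders V (bar_cylinder w H F).
    by right; exists w, H, F; split=> // a [].
  have Zy : bar_cylinder w H F (val y).
    split; first exact/cylinderP.
    by rewrite size_mkseq -/(entry y i) yE; split; [right|move=> []].
  have nZ := nbhs_generalized_cylinder Zb Zy.
  apply: (@filterS _ _ (nbhs_filter y) _ _ _ nZ) => z [_].
  rewrite size_mkseq -/(entry z i) => -[[[a Ha za]|->]//= Fz _].
  rewrite -za /=.
  have [[-> ->]//|] := pselect (owner a = Some H /\ (k <= rank a)%N).
  move=> nfar; case: Fz; exists a => //; split=> //.
  exact: letters_entry hL (esym za).
apply: (@filterS _ _ (nbhs_filter y) _ _ _ near_same) => z yz.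
apply: eq_truncation => i ik.
exact: yz (Ordinal ik).
Qed.

End Truncation.

Theorem theorem3p15 (R : realType) (A : pointedType) (V : set (set A))
    (L : set (nat -> A)) (hV : resolution V) (hL : shift_space L)
    (hfc : first_countable (set_type (blur_shift V L)))
    (hcond : countable (resolution_in V L) \/
       (forall H, resolution_in V L H ->
          finite_set [set h | H h /\
            exists G, [/\ resolution_in V L G, G <> H & G h]])) :
  metrizable R (set_type (blur_shift V L)).
Proof.
have [|D [DH Ddisj Dfin]] := disjoint_cores _ hcond.
  by move=> G H [VG _] [VH _]; apply: hV.2.
have owned (a : A) : exists o : option V, forall H : V,
    o = Some H <-> resolution_in V L (val H) /\ D (val H) a.
  have [[H [WH DHa]]|no] :=
      pselect (exists H : V, resolution_in V L (val H) /\ D (val H) a).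
    exists (Some H) => G; split=> [[<-]//|[WG DGa]].
    by congr Some; apply: val_inj; exact: Ddisj DHa DGa.
  by exists None => H; split=> // Ha; case: no; exists H.
have [owner ownerP] := choice owned.
have counted (H : V) : exists r : A -> nat,
    resolution_in V L (val H) -> {in letters L `&` val H &, injective r}.
  have [WH|nWH] := pselect (resolution_in V L (val H));
    last by exists (fun=> 0%N).
  by have /countable_injP[r rinj] := first_countable_letters hfc WH; exists r.
have [r rinj] := choice counted.
(* Letters outside all the cores are fixed by every coarsening, so any value
   serves as their rank. *)
pose rank a := if owner a is Some H then r H a else 0%N.
apply: (@metrizable_locally_constant _ _ _
  (@truncation A V L owner rank)).
- move=> k x; apply: nbhs_truncation => // H j WH.
  apply: (@sub_finite_set _ _ ((val H `\` D (val H)) `|`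
      [set a | (letters L `&` val H) a /\ (r H a < j)%N])).
    move=> a [La Ha nfar].
    have [DHa|nDHa] := pselect (D (val H) a); last by left.
    right; split=> //; rewrite ltnNge; apply/negP => ja; apply: nfar.
    have oa : owner a = Some H by apply/ownerP.
    by split=> //; rewrite /rank oa.
  rewrite finite_setU; split; first exact: Dfin.
  exact: finite_injective_lt (rinj _ WH).
- move=> x U; apply: truncation_sub_nbhs => a H /ownerP[_]; exact: DH.
- exact: truncation_inj.
Qed.
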